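(* Let $p^a$ be a probability density on $\mathcal{D}=\prod_{i=1}^N\mathcal{D}_i$ with respect to Lebesgue measure which is by itself a Markov random field, and put $V^a(x)=\log\frac{p^a(x)}{p^a(r)}$. Let $c_A$, $\varnothing\ne A\subseteq S=\{1,\dots,N\}$, be arbitrary real constants and put $$V^d(x)=\sum_{\varnothing\ne A\subseteq S}c_A\prod_{i\in A}\mathbf 1^*_{r_i}(x_i).$$ Suppose that a real mixed states Markov random field has joint density with respect to $m$ $$p^m(x)=\frac{e^{V^d(x)+V^a(x)}}{Z^m},\qquad Z^m=\int_{\mathcal{D}}e^{V^d+V^a}\,dm<\infty .$$ Then for every $l\in S$ and every $x\in\mathcal{D}$ the conditional densities of $p^m$ are $$p^m(x_l\mid x_l^c)=\rho_l(x_l^c)\,\mathbf 1_{r_l}(x_l)+\bigl(1-\rho_l(x_l^c)\bigr)\,\mathbf 1^*_{r_l}(x_l)\,p^a(x_l\mid x_l^c),$$ where $$\rho_l(x_l^c)=p^m(r_l\mid x_l^c)=\frac{1}{1+\dfrac{e^{h_l(x_l^c)}}{p^a(r_l\mid x_l^c)}},\qquad h_l(x_l^c)=\sum_{A\subseteq S,\ l\in A}c_A\prod_{j\in A\setminus\{l\}}\mathbf 1^*_{r_j}(x_j),$$ and an empty product equals $1$.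
   Context: **Spaces and measures.** $N\ge 1$ and $n_1,\dots,n_N\ge 1$ are integers, and $S=\{1,\dots,N\}$. For each $i$, $\mathcal{D}_i=\mathbb{R}^{n_i}$, with a fixed distinguished (''ground'') point $r_i\in\mathbb{R}^{n_i}$ at which probability mass may be concentrated. $\mathcal{D}=\mathcal{D}_1\times\cdots\times\mathcal{D}_N$ and $r=(r_1,\dots,r_N)$. For $x=(x_1,\dots,x_N)\in\mathcal{D}$, $x_i^c=(x_j)_{j\ne i}$. On $\mathcal{D}_i$ let $m_i=\delta_{r_i}+\lambda_i$, where $\delta_{r_i}$ is the unit point mass at $r_i$ and $\lambda_i$ is Lebesgue measure on $\mathbb{R}^{n_i}$; $m=m_1\times\cdots\times m_N$ is the product measure on the Borel sets of $\mathcal{D}$. ''Lebesgue measure'' on $\mathcal{D}$ is $\lambda_1\times\cdots\times\lambda_N$. **Indicators.** $\mathbf 1_{r_i}(x_i)=1$ if $x_i=r_i$ and $0$ otherwise; $\mathbf 1^*_{r_i}(x_i)=1-\mathbf 1_{r_i}(x_i)$. **Markov random fields.** A real mixed states Markov random field is given by a probability density $p^m$ with respect to $m$ (so $\int_{\mathcal{D}} p^m\,dm=1$) with $p^m(x)>0$ for every $x\in\mathcal{D}$. A probability density $p^a$ with respect to Lebesgue measure on $\mathcal{D}$ is by itself a Markov random field if $p^a(x)>0$ for every $x\in\mathcal{D}$. **Conditional densities.** These are the pointwise-defined functions $p^m(x_i\mid x_i^c)=p^m(x)/\int_{\mathcal{D}_i}p^m(x)\,m_i(dx_i)$ and $p^a(x_i\mid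 x_i^c)=p^a(x)/\int_{\mathcal{D}_i}p^a(x)\,dx_i$. The one-site integrals in the denominators are assumed finite for every $x_i^c$, so that the conditional densities are defined everywhere. *)

(* Defs.v *)
From HB Require Import structures.
From mathcomp Require Import all_boot all_order all_algebra.
From mathcomp Require Import all_classical all_reals all_analysis.
From mathcomp Require Import measurable_realfun.

Set Implicit Arguments.
Unset Strict Implicit.
Unset Printing Implicit Defensive.
Import Order.TTheory GRing.Theory Num.Theory.
Import numFieldNormedType.Exports.

Local Open Scope classical_set_scope.
Local Open Scope ring_scope.

(* Finite products of measurable spaces: dependent functions with the
   sigma-algebra generated by the coordinate projections. *)

Definition prod_space d (N : nat) (T : 'I_N -> measurableType d) : Type :=
  forall i, T i.

Definition prod_space_display : measure_display -> measure_display.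
Proof. exact. Qed.

Section prod_space_measurable.
Context (d : measure_display) (N : nat) (T : 'I_N -> measurableType d).

HB.instance Definition _ := Pointed.copy (prod_space T) (forall i, T i).

Definition cylinders : set (set (prod_space T)) :=
  \bigcup_(i in [set: 'I_N])
    preimage_set_system setT (fun x : prod_space T => x i) measurable.

Let prod_set0 : <<s cylinders >> set0.
Proof. exact: sigma_algebra0. Qed.

Let prod_setC A : <<s cylinders >> A -> <<s cylinders >> (~` A).
Proof. exact: sigma_algebraC. Qed.

Let prod_bigcup (F : (set (prod_space T))^nat) :
  (forall i, <<s cylinders >> (F i)) -> <<s cylinders >> (\bigcup_i F i).
Proof. exact: sigma_algebra_bigcup. Qed.

HB.instance Definition _ := @isMeasurable.Build (prod_space_display d)
  (prod_space T) <<s cylinders >> prod_set0 prod_setC prod_bigcup.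

Lemma measurable_coord i : measurable_fun setT (fun x : prod_space T => x i).
Proof.
move=> _ Y mY; apply: sub_sigma_algebra; exists i => //=.
by exists Y.
Qed.

Lemma measurable_fun_prod_space d' (X : measurableType d')
    (f : X -> prod_space T) :
  (forall i, measurable_fun setT (fun x => f x i)) -> measurable_fun setT f.
Proof.
move=> mf _ Y; rewrite setTI.
suff : <<s cylinders >> `<=` [set A | measurable (f @^-1` A)] by apply.
apply: smallest_sub.
- split => /=; first by rewrite preimage_set0.
  + by move=> A mA; rewrite setTD preimage_setC; exact: measurableC.
  + by move=> F mF; rewrite preimage_bigcup; exact: bigcupT_measurable.
- move=> A [i _ [B mB <-]] /=; rewrite setTI.
  by rewrite -[X in measurable X]setTI; exact: mf.
Qed.

Lemma measurable_dfwith i : measurable_fun setT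
  (fun p : prod_space T * T i => dfwith p.1 i p.2 : prod_space T).
Proof.
apply: measurable_fun_prod_space => j.
have [ij|ij] := eqVneq i j.
  subst j; apply: (eq_measurable_fun snd) => //.
  by move=> p _; rewrite dfwithin.
apply: (eq_measurable_fun (fun p : prod_space T * T i => p.1 j)).
  by move=> p _; rewrite dfwithout.
by apply: (measurableT_comp (@measurable_coord j)).
Qed.

End prod_space_measurable.

Definition box d (N : nat) (T : 'I_N -> measurableType d)
  (A : forall i, set (T i)) : set (prod_space T) :=
  [set x | forall i, A i (x i)].

Section product_measure.
Local Open Scope ereal_scope.
Context (R : realType) (d : measure_display) (N : nat)
  (T : 'I_N -> measurableType d)
  (mu : forall i, {sigma_finite_measure set (T i) -> \bar R}).

(* Integrates out the coordinates listed in [s], the last one first. *)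
Definition iterated_integral (s : seq 'I_N) (f : prod_space T -> \bar R) :
    prod_space T -> \bar R :=
  foldr (fun i (g : prod_space T -> \bar R) x =>
    \int[mu i]_y g (dfwith x i y)) f s.

(* The product measure [mu 0 x ... x mu (N - 1)], as the iterated integral of
   the indicator; by [product_measure_box] and sigma-finiteness it is the
   unique measure that is multiplicative on boxes.  Every coordinate is
   integrated out, so the base point is irrelevant. *)
Definition product_measure (A : set (prod_space T)) : \bar R :=
  iterated_integral (enum 'I_N) (EFin \o \1_A) point.

Implicit Types (s : seq 'I_N) (f : prod_space T -> \bar R).

Lemma iterated_integral_ge0 s f x :
  (forall x, 0 <= f x) -> 0 <= iterated_integral s f x.
Proof.
move=> f0; elim: s x => [//|i s ih] x /=.
by apply: integral_ge0 => y _; exact: ih.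
Qed.

Lemma measurable_iterated_integral s f :
  (forall x, 0 <= f x) -> measurable_fun setT f ->
  measurable_fun setT (iterated_integral s f).
Proof.
move=> f0 mf; elim: s => [//|i s ih] /=.
apply: (@measurable_fun_fubini_tonelli_F _ _ _ _ _ (mu i)
  (fun p : prod_space T * T i => iterated_integral s f (dfwith p.1 i p.2))).
- by apply: (measurableT_comp ih); exact: measurable_dfwith.
- by move=> p; exact: iterated_integral_ge0.
Qed.

Lemma measurable_section f i (x : prod_space T) : measurable_fun setT f ->
  measurable_fun setT (fun y : T i => f (dfwith x i y) : \bar R).
Proof.
move=> mf; apply: (measurableT_comp mf).
exact: (measurableT_comp (measurable_dfwith (i := i)) (pair1_measurable x)).
Qed.

Lemma iterated_integral_nneseries s (f : (prod_space T -> \bar R)^nat) :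
  (forall n x, 0 <= f n x) -> (forall n, measurable_fun setT (f n)) ->
  iterated_integral s (fun x => \sum_(n <oo) f n x) =
  fun x => \sum_(n <oo) iterated_integral s (f n) x.
Proof.
move=> f0 mf; elim: s => [//|i s ih] /=; rewrite ih.
apply/funext => x; rewrite integral_nneseries//.
- move=> n; apply: (@measurable_section (iterated_integral s (f n))).
  exact: measurable_iterated_integral.
- by move=> n y _; exact: iterated_integral_ge0.
Qed.

Let product_measure0 : product_measure set0 = 0.
Proof.
rewrite /product_measure.
have -> : EFin \o \1_(@set0 (prod_space T)) = (fun _ => 0 : \bar R).
  by apply/funext => x /=; rewrite indic0.
suff -> : forall s, iterated_integral s (fun _ => 0) = fun _ => 0 by [].
by elim=> [//|i s ih] /=; apply/funext => x; rewrite ih integral0.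
Qed.

Let product_measure_ge0 A : 0 <= product_measure A.
Proof. by apply: iterated_integral_ge0 => x; rewrite lee_fin. Qed.

Let product_measure_sigma_additive : semi_sigma_additive product_measure.
Proof.
move=> F mF tF mUF.
have -> : product_measure (\bigcup_n F n) = \sum_(n <oo) product_measure (F n).
  have F0 n (x : prod_space T) : 0 <= (EFin \o \1_(F n)) x :> \bar R.
    by rewrite lee_fin.
  have mF1 n : measurable_fun setT (EFin \o \1_(F n) : prod_space T -> \bar R).
    by apply/measurable_EFinP; exact: measurable_indic.
  rewrite /product_measure.
  rewrite -[RHS](congr1 (fun h => h point)
    (@iterated_integral_nneseries (enum 'I_N) _ F0 mF1)).
  congr (iterated_integral _ _ _); apply/funext => x /=.
  exact: indic_bigcup.
exact: is_cvg_ereal_nneg_natsum.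
Qed.

HB.instance Definition _ := isMeasure.Build _ _ _ product_measure
  product_measure0 product_measure_ge0 product_measure_sigma_additive.

Lemma measurable_box (A : forall i, set (T i)) :
  (forall i, measurable (A i)) -> measurable (box A).
Proof.
move=> mA.
have -> : box A = \bigcap_(i in [set: 'I_N])
    ((fun x : prod_space T => x i) @^-1` A i).
  by apply/seteqP; split => x Ax i; [move=> _; exact: Ax|exact: Ax].
apply: fin_bigcap_measurable => // i _; rewrite -[X in measurable X]setTI.
exact: (measurable_coord measurableT (mA i)).
Qed.

Lemma product_measure_box (A : forall i, set (T i)) :
  (forall i, measurable (A i)) ->
  product_measure (box A) = \prod_(i < N) mu i (A i).
Proof.
move=> mA.
have H s : uniq s -> forall x,
    iterated_integral s (EFin \o \1_(box A)) x =
    (\prod_(i <- s) mu i (A i)) * (\prod_(i | i \notin s) \1_(A i) (x i))%R%:E.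
  elim: s => [_ x|i s ih /= /andP[iNs us] x].
    rewrite big_nil mul1e /=; congr EFin; rewrite indicE.
    have [xA|xA] := boolP (x \in box A).
      rewrite big1// => i _; rewrite indicE mem_set//.
      by move/set_mem : xA; exact.
    have [i Ai] : exists i, ~ A i (x i).
      by apply/existsNP => xA'; move/negP : xA; apply; exact: mem_set.
    by rewrite (bigD1 i)//= indicE memNset// mul0r.
  under eq_integral.
    move=> y _; rewrite (ih us) (bigD1 i)//= dfwithin.
    rewrite (eq_bigr (fun j => \1_(A j) (x j))%R); last first.
      by move=> j /andP[_ ji]; rewrite dfwithout// eq_sym.
    rewrite mulrC EFinM muleA.
    over.
  rewrite /= ge0_integralZl//; last 2 first.
    by apply/measurable_EFinP; exact: measurable_indic.
    rewrite mule_ge0// ?lee_fin ?prodr_ge0//.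
    by elim/big_ind : _ => // a b; exact: mule_ge0.
  rewrite integral_indic// setIT big_cons [LHS]muleC -muleA.
  congr (_ * (_ * _%:E)).
  by apply: eq_bigl => j; rewrite inE negb_or andbC.
rewrite /product_measure H ?enum_uniq// [X in _ * X%:E]big1 ?mule1; last first.
  by move=> i; rewrite mem_enum.
by rewrite big_enum.
Qed.

Let product_measure_sigma_finite : sigma_finite setT product_measure.
Proof.
pose F (i : 'I_N) :=
  sval (cid ((sigma_finiteP setT (mu i)).1 (sigma_finiteT (mu i)))).
have FP i : [/\ setT = \bigcup_k F i k, nondecreasing_seq (F i) &
    forall k, measurable (F i k) /\ mu i (F i k) < +oo].
  by rewrite /F; case: cid.
exists (fun k => box (fun i => F i k)).
  apply/esym; rewrite -subTset => x _.
  have /choice[k kP] : forall i, exists k, F i k (x i).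
    move=> i; have [FT _ _] := FP i.
    have : (\bigcup_k F i k) (x i) by rewrite -FT.
    by case=> k _; exists k.
  exists (\max_(i < N) k i)%N => // i.
  have [_ ndF _] := FP i.
  have /subsetPset := ndF (k i) _ (leq_bigmax (F := k) i).
  by apply; exact: kP.
move=> k; have mF i : measurable (F i k) by have [_ _ /(_ k)[]] := FP i.
split; first exact: measurable_box.
rewrite product_measure_box//.
have : \prod_(i < N) mu i (F i k) \is a fin_num.
  elim/big_ind : _ => [//|a b|i _]; first exact: fin_numM.
  by rewrite ge0_fin_numE//; have [_ _ /(_ k)[]] := FP i.
by move/fin_numPlt => /andP[].
Qed.

HB.instance Definition _ := Measure_isSigmaFinite.Build _ _ _ product_measure
  product_measure_sigma_finite.

End product_measure.

Section lebesgue_tuple.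
Local Open Scope ereal_scope.
Context (R : realType) (n : nat).

Local Notation coords := (prod_space (fun _ : 'I_n => measurableTypeR R)).

Definition tuple_of_coords (x : coords) : n.-tuple (measurableTypeR R) :=
  [tuple x i | i < n].

Lemma measurable_tuple_of_coords : measurable_fun setT tuple_of_coords.
Proof.
apply/measurable_fun_tnthP => i.
apply: (eq_measurable_fun (fun x : coords => x i)).
  by move=> x _ /=; rewrite tnth_mktuple.
exact: measurable_coord.
Qed.

(* Lebesgue measure on [R^n], with [R^n] represented by [n]-tuples. *)
Definition lebesgue_tuple : set (n.-tuple (measurableTypeR R)) -> \bar R :=
  pushforward
    (product_measure (fun _ : 'I_n => @lebesgue_measure R)) tuple_of_coords.

Let lebesgue_tuple0 : lebesgue_tuple set0 = 0.
Proof. by rewrite /lebesgue_tuple /pushforward preimage_set0 measure0. Qed.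

Let lebesgue_tuple_ge0 A : 0 <= lebesgue_tuple A.
Proof. by rewrite /lebesgue_tuple /pushforward; exact: measure_ge0. Qed.

Let lebesgue_tuple_sigma_additive : semi_sigma_additive lebesgue_tuple.
Proof.
have mpre A : measurable A -> measurable (tuple_of_coords @^-1` A).
  move=> mA; rewrite -[X in measurable X]setTI.
  exact: measurable_tuple_of_coords.
move=> F mF tF mUF; rewrite /lebesgue_tuple /pushforward preimage_bigcup.
apply: measure_semi_sigma_additive.
- by move=> k; exact: mpre.
- apply/trivIsetP => /= i j _ _ ij; rewrite -preimage_setI.
  by move/trivIsetP : tF => /(_ _ _ _ _ ij) ->//; rewrite preimage_set0.
- by rewrite -preimage_bigcup; exact: mpre.
Qed.

HB.instance Definition _ := isMeasure.Build _ _ _ lebesgue_tuple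
  lebesgue_tuple0 lebesgue_tuple_ge0 lebesgue_tuple_sigma_additive.

Let tuple_box (A : 'I_n -> set (measurableTypeR R)) :
  set (n.-tuple (measurableTypeR R)) := [set t | forall i, A i (tnth t i)].

Let preimage_tuple_box A : tuple_of_coords @^-1` tuple_box A = box A.
Proof.
by apply/seteqP; split => x Ax i; move: (Ax i); rewrite /= tnth_mktuple.
Qed.

Lemma lebesgue_tuple_box (A : 'I_n -> set (measurableTypeR R)) :
  (forall i, measurable (A i)) ->
  lebesgue_tuple [set t | forall i, A i (tnth t i)] =
  \prod_(i < n) lebesgue_measure (A i).
Proof.
move=> mA; rewrite /lebesgue_tuple /pushforward preimage_tuple_box.
exact: product_measure_box.
Qed.

Let lebesgue_tuple_sigma_finite : sigma_finite setT lebesgue_tuple.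
Proof.
have [F FT mF] := sigma_finiteT
  (product_measure (fun _ : 'I_n => @lebesgue_measure R)).
pose g (t : n.-tuple (measurableTypeR R)) : coords := fun i => tnth t i.
have gK x : g (tuple_of_coords x) = x.
  by apply/funext => i; rewrite /g tnth_mktuple.
have mg : measurable_fun setT g.
  by apply: measurable_fun_prod_space => i; exact: measurable_tnth.
exists (fun k => g @^-1` F k).
  by rewrite -preimage_bigcup -FT preimage_setT.
move=> k; have [mFk muFk] := mF k; split.
  by rewrite -[X in measurable X]setTI; exact: mg.
rewrite /lebesgue_tuple /pushforward -comp_preimage.
by rewrite (_ : g \o tuple_of_coords = id)//; apply/funext.
Qed.

HB.instance Definition _ := Measure_isSigmaFinite.Build _ _ _ lebesgue_tuple
  lebesgue_tuple_sigma_finite.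

End lebesgue_tuple.

Section mixed_measure.
Local Open Scope ereal_scope.
Context (R : realType) (d : measure_display) (T : measurableType d).
Variables (r : T) (mu : {sigma_finite_measure set T -> \bar R}).

Definition mixed_measure : set T -> \bar R := measure_add (dirac r) mu.

HB.instance Definition _ := Measure.on mixed_measure.

Let mixed_measure_sigma_finite : sigma_finite setT mixed_measure.
Proof.
have [F FT mF] := sigma_finiteT mu.
exists F => // k; have [mFk muFk] := mF k; split => //.
rewrite /mixed_measure measure_addE lte_add_pinfty//.
by rewrite (le_lt_trans _ (ltry 1))//= diracE lee_fin; case: (_ \in _).
Qed.

HB.instance Definition _ := Measure_isSigmaFinite.Build _ _ _ mixed_measure
  mixed_measure_sigma_finite.

End mixed_measure.

Section random_field.
Context (R : realType) (d : measure_display) (N : nat)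
  (T : 'I_N -> measurableType d)
  (mu : forall i, {sigma_finite_measure set (T i) -> \bar R}).

(* Everywhere positive probability density with respect to the product of the
   [mu i]. *)
Definition mrf_density (p : prod_space T -> R) : Prop :=
  [/\ measurable_fun setT p, forall x, 0 < p x &
      (\int[product_measure mu]_x (p x)%:E = 1)%E].

Definition one_site_finite (p : prod_space T -> R) : Prop :=
  forall i (x : prod_space T), (\int[mu i]_y (p (dfwith x i y))%:E < +oo)%E.

(* [cond_density p i y x] is p(y | x_i^c): only the coordinates of [x] other
   than [i] matter, since [dfwith x i y] is [x] with its [i]-th coordinate
   replaced by [y].  The conditional density at [x] itself is
   [cond_density p i (x i) x]; see [cond_densityE]. *)
Definition cond_density (p : prod_space T -> R) (i : 'I_N) (y : T i)
    (x : prod_space T) : R :=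
  p (dfwith x i y) / \int[mu i]_z p (dfwith x i z).

Arguments cond_density : clear implicits.

Lemma cond_densityE p i x : cond_density p i (x i) x =
  p x / \int[mu i]_z p (dfwith x i z).
Proof.
rewrite /cond_density; congr (p _ / _).
apply: functional_extensionality_dep => j.
by case: dfwithP.
Qed.

End random_field.
Arguments cond_density {R d N T} mu p i y x.

Section mixed_states.
Context (R : realType) (N : nat) (n : 'I_N -> nat).

(* The space D = R^(n 0) x ... x R^(n (N - 1)). *)
Definition config : Type :=
  prod_space (fun i => (n i).-tuple (measurableTypeR R)).

Definition lebesgue_site (i : 'I_N) :
    {sigma_finite_measure set (n i).-tuple (measurableTypeR R) -> \bar R} :=
  @lebesgue_tuple R (n i).

Variables (r : config) (c : {set 'I_N} -> R).

Definition mixed_site (i : 'I_N) :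
    {sigma_finite_measure set (n i).-tuple (measurableTypeR R) -> \bar R} :=
  mixed_measure (r i) (lebesgue_site i).

(* [ground i x] is 1_{r_i}(x_i) and [nonground i x] is 1^*_{r_i}(x_i). *)
Definition ground (i : 'I_N) (x : config) : R := \1_[set r i] (x i).

Definition nonground (i : 'I_N) (x : config) : R := 1 - ground i x.

(* V^d; the value of [c] at the empty set is never used. *)
Definition discrete_potential (x : config) : R :=
  \sum_(A : {set 'I_N} | A != finset.set0) c A * \prod_(i in A) nonground i x.

(* V^a *)
Definition continuous_potential (pa : config -> R) (x : config) : R :=
  ln (pa x / pa r).

(* h_l; it does not depend on [x l]. *)
Definition site_potential (l : 'I_N) (x : config) : R :=
  \sum_(A : {set 'I_N} | l \in A) c A *
    \prod_(j in (A :\ l)%SET) nonground j x.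

End mixed_states.

(* Main.v *)
Require Import Defs.
From mathcomp Require Import all_boot all_order all_algebra.
From mathcomp Require Import all_classical all_reals all_analysis.
From mathcomp Require Import measurable_realfun.
From mathcomp Require Import ring.

Set Implicit Arguments.
Unset Strict Implicit.
Unset Printing Implicit Defensive.
Import Order.TTheory GRing.Theory Num.Theory.
Import numFieldNormedType.Exports.

Local Open Scope classical_set_scope.
Local Open Scope ring_scope.

(** Fix every coordinate of [x] but the [l]-th.  In [discrete_potential], only
    the sets containing [l] see the moving coordinate [y], and each of them
    carries the factor which is 0 at [y = r l] and 1 elsewhere
    ([discrete_potential_dfwith]).  Hence, for some positive [C] that does
    not involve [y],
    [pm (dfwith x l y)] is [C * pa (dfwith x l (r l))] when [y = r l] and
    [C * expR h * pa (dfwith x l y)] otherwise, where [h] is the site potential.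
    The one-site reference measure is an atom at [r l] plus a measure that does
    not charge [r l], so the normalising integral of this line is
    [C * (pa (dfwith x l (r l)) + expR h * I)], with [I] the one-site Lebesgue
    integral of [pa] ([Rintegral_mixed_measure]).  The constant [C], which contains both
    the partition function and all the interactions away from [l], cancels in
    the conditional density, and what remains is algebra.  Dividing by [I]
    requires [I > 0] on every line, which follows from the pointwise
    positivity of [pa], the whole site having nonzero Lebesgue measure
    ([Rintegral_gt0], [lebesgue_tuple_setT_neq0]). *)

(** The integral of a nonnegative function vanishes only if the function does
    almost everywhere; here the exceptional set would be the whole space,
    which is not null. *)
Lemma Rintegral_gt0 (R : realType) (d : measure_display)
    (T : measurableType d) (mu : {measure set T -> \bar R}) (f : T -> R) :
  mu setT != 0%E -> measurable_fun setT f -> (forall y, 0 < f y) ->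
  (\int[mu]_y (f y)%:E < +oo)%E -> 0 < \int[mu]_y f y.
Proof.
move=> muT mf f0 foo; apply: fine_gt0; rewrite foo andbT lt0e.
apply/andP; split; last by apply: integral_ge0 => y _; rewrite lee_fin ltW.
apply: contra_neq muT => int0.
have mEf : measurable_fun setT (EFin \o f) by exact/measurable_EFinP.
have [] := (ae_eq_integral_abs mu measurableT mEf).1.
  rewrite -[RHS]int0; apply: eq_integral => y _ /=.
  by rewrite gtr0_norm.
move=> A [mA muA0 subA]; apply/eqP; rewrite -measure_le0 -muA0.
apply: le_measure; rewrite ?inE// => y _; apply: subA => /= /(_ I) [fy0].
by have := f0 y; rewrite fy0 ltxx.
Qed.

(** The atom sees only [f r], and the part [mu] does not see it, so that [f] may
    be replaced there by [a * g]. *)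
Lemma Rintegral_mixed_measure (R : realType) (d : measure_display)
    (T : measurableType d) (mu : {sigma_finite_measure set T -> \bar R})
    (r : T) (f g : T -> R) (a : R) :
  measurable [set r] -> mu [set r] = 0%E -> 0 <= a ->
  measurable_fun setT f -> (forall y, 0 <= f y) ->
  measurable_fun setT g -> (forall y, 0 <= g y) ->
  (\int[mu]_y (g y)%:E < +oo)%E ->
  (forall y, y != r -> f y = a * g y) ->
  \int[mixed_measure r mu]_y f y = f r + a * \int[mu]_y g y.
Proof.
move=> mr mur a0 mf f0 mg g0 goo fg.
have mEf : measurable_fun setT (EFin \o f) by exact/measurable_EFinP.
have mEg : measurable_fun setT (EFin \o g) by exact/measurable_EFinP.
have int_f : (\int[mu]_y (f y)%:E = a%:E * \int[mu]_y (g y)%:E)%E.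
  rewrite -ge0_integralZl//; last 1 first.
    by move=> y _; rewrite lee_fin.
  apply: ge0_ae_eq_integral => //.
  - exact: measurable_funeM.
  - by move=> y _; rewrite lee_fin.
  - by move=> y _; rewrite mule_ge0// lee_fin.
  exists [set r]; split=> // y /= /not_implyP[_ fy].
  by apply/eqP/negPn/negP => yr; apply: fy; rewrite fg// EFinM.
have gfin : (\int[mu]_y (g y)%:E)%E \is a fin_num.
  by rewrite ge0_fin_numE//; apply: integral_ge0 => y _; rewrite lee_fin.
rewrite /Rintegral ge0_integral_measure_add//; last first.
  by move=> y _; rewrite lee_fin.
rewrite integral_dirac// diracT mul1e int_f.
by rewrite fineD//= ?fineM// fin_numM.
Qed.

Section lebesgue_tuple_facts.
Context (R : realType) (n : nat).

Local Notation Rn := (n.-tuple (measurableTypeR R)).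

Lemma measurable_tuple_box (A : 'I_n -> set (measurableTypeR R)) :
  (forall i, measurable (A i)) ->
  measurable [set t : Rn | forall i, A i (tnth t i)].
Proof.
move=> mA.
have -> : [set t : Rn | forall i, A i (tnth t i)] =
    \bigcap_(i in [set: 'I_n]) ((fun t : Rn => tnth t i) @^-1` A i).
  by apply/seteqP; split => t At i; [move=> _; exact: At|exact: At].
apply: fin_bigcap_measurable => // i _; rewrite -[X in measurable X]setTI.
by apply: measurable_tnth => //; exact: mA.
Qed.

Let set1_box (t : Rn) :
  [set t] = [set u : Rn | forall i, [set tnth t i] (tnth u i)].
Proof. by apply/seteqP; split => [u -> //|u /= ut]; exact: eq_from_tnth. Qed.

Lemma measurable_tuple_set1 (t : Rn) : measurable [set t].
Proof.
rewrite set1_box.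
apply: (@measurable_tuple_box (fun i => [set tnth t i])) => i.
exact: measurable_set1.
Qed.

(** Some factor of the product is the length of a point; [R^0] has no factor,
    and its points have mass one. *)
Lemma lebesgue_tuple_set1 (t : Rn) : (0 < n)%N -> lebesgue_tuple [set t] = 0%E.
Proof.
move=> n0; rewrite set1_box.
rewrite (@lebesgue_tuple_box _ _ (fun i => [set tnth t i])); last first.
  by move=> i; exact: measurable_set1.
by rewrite (bigD1 (Ordinal n0))//= lebesgue_measure_set1 mul0e.
Qed.

(** The unit cube already has mass one. *)
Lemma lebesgue_tuple_setT_neq0 : lebesgue_tuple [set: Rn] != 0%E.
Proof.
pose I01 (i : 'I_n) : set (measurableTypeR R) := `[0, 1]%classic.
have mI i : measurable (I01 i) by exact: measurable_itv.
apply/negP => /eqP T0.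
have : (lebesgue_tuple [set t : Rn | forall i, I01 i (tnth t i)] <=
        lebesgue_tuple [set: Rn])%E.
  apply: (le_measure (@lebesgue_tuple R n)); rewrite ?inE//.
  exact: measurable_tuple_box.
rewrite T0 (@lebesgue_tuple_box _ _ I01)// big1 ?leNgt ?lte01// => i _.
by rewrite lebesgue_measure_itv/= lte_fin ltr01 oppr0 adde0.
Qed.

End lebesgue_tuple_facts.

Section potentials.
Context (R : realType) (N : nat) (n : 'I_N -> nat) (r : config R n).
Implicit Types (x : config R n) (l : 'I_N).

Lemma nonground_dfwith_neq x l (y : (n l).-tuple (measurableTypeR R)) j :
  j != l -> nonground r j (dfwith x l y) = nonground r j x.
Proof. by move=> jl; rewrite /nonground /ground dfwithout// eq_sym. Qed.

Lemma nonground_dfwith x l (y : (n l).-tuple (measurableTypeR R)) :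
  nonground r l (dfwith x l y) = (y != r l)%:R.
Proof.
rewrite /nonground /ground dfwithin indicE.
have [->|yr] := eqVneq y (r l); first by rewrite mem_set// subrr.
by rewrite memNset ?subr0// => /eqP; rewrite (negbTE yr).
Qed.

(** The terms indexed by the sets avoiding [l] do not depend on [y], and those
    indexed by the sets containing [l] vanish at the ground point, so the value
    there collects exactly the former. *)
Lemma discrete_potential_dfwith (c : {set 'I_N} -> R) x l
    (y : (n l).-tuple (measurableTypeR R)) :
  discrete_potential r c (dfwith x l y) =
  discrete_potential r c (dfwith x l (r l)) +
  (y != r l)%:R * site_potential r c l x.
Proof.
have split_l z : discrete_potential r c (dfwith x l z) =
    \sum_(A : {set 'I_N} | (A != finset.set0) && (l \notin A))
      c A * \prod_(i in A) nonground r i x +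
    (z != r l)%:R * site_potential r c l x.
  rewrite /discrete_potential (bigID (fun A : {set 'I_N} => l \notin A))/=.
  congr (_ + _).
    apply: eq_bigr => A /andP[_ lA]; congr (_ * _); apply: eq_bigr => i iA.
    by rewrite nonground_dfwith_neq//; apply: contraNneq lA => <-.
  rewrite /site_potential mulr_sumr; apply: eq_big => [A|A /andP[_]].
    rewrite negbK; case: (boolP (l \in A)) => [lA|]; last by rewrite andbF.
    by rewrite andbT; apply: contraTneq lA => ->; rewrite finset.in_set0.
  rewrite negbK => lA; rewrite (finset.big_setD1 l)//= nonground_dfwith.
  rewrite mulrCA; congr (_ * (_ * _)); apply: eq_bigr => i.
  by rewrite finset.in_setD1 => /andP[il _]; rewrite nonground_dfwith_neq.
by rewrite split_l [in RHS]split_l eqxx mul0r addr0.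
Qed.

End potentials.

Theorem mainTheorem2 (R : realType) (N : nat) (N_gt0 : (0 < N)%N)
    (n : 'I_N -> nat) (n_gt0 : forall i, (0 < n i)%N) (r : config R n)
    (pa : config R n -> R)
    (pa_mrf : mrf_density (lebesgue_site R n) pa)
    (pa_fin : one_site_finite (lebesgue_site R n) pa)
    (c : {set 'I_N} -> R)
    (pm : config R n -> R)
    (pm_mrf : mrf_density (mixed_site r) pm)
    (pm_fin : one_site_finite (mixed_site r) pm) :
  let V := fun x : config R n =>
    discrete_potential r c x + continuous_potential r pa x in
  let Z : \bar R :=
    (\int[product_measure (mixed_site r)]_x (expR (V x))%:E)%E in
  (Z < +oo)%E ->
  (forall x, pm x = expR (V x) / fine Z) ->
  forall (l : 'I_N) (x : config R n),
    let rho := cond_density (mixed_site r) pm l (r l) x in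
    cond_density (mixed_site r) pm l (x l) x =
      rho * ground r l x +
      (1 - rho) * nonground r l x *
        cond_density (lebesgue_site R n) pa l (x l) x /\
    rho = 1 / (1 + expR (site_potential r c l x) /
                   cond_density (lebesgue_site R n) pa l (r l) x).
Proof.
move=> V Z _ pmE l x rho.
have [mpa pa0 _] := pa_mrf; have [mpm pm0 _] := pm_mrf.
have msec (p : prod_space (fun i => (n i).-tuple (measurableTypeR R)) -> R) :
    measurable_fun setT p -> measurable_fun setT
      (fun y : (n l).-tuple (measurableTypeR R) => p (dfwith x l y)).
  move=> /measurable_EFinP mp; apply/measurable_EFinP.
  exact: (measurable_section (i := l) x mp).
pose h := site_potential r c l x.
pose C := expR (discrete_potential r c (dfwith x l (r l))) / pa r / fine Z.
pose I := \int[lebesgue_site R n l]_y pa (dfwith x l y).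
have pm_section y :
    pm (dfwith x l y) = C * (expR ((y != r l)%:R * h) * pa (dfwith x l y)).
  rewrite pmE /V /continuous_potential discrete_potential_dfwith !expRD.
  by rewrite lnK ?posrE ?divr_gt0// /C -/h; ring.
(* [fine Z] is a factor of [C], and its positivity is read off that of [pm]. *)
have C0 : 0 < C.
  have := pm0 (dfwith x l (r l)).
  by rewrite pm_section pmulr_lgt0// mulr_gt0// expR_gt0.
have I0 : 0 < I.
  apply: Rintegral_gt0 => //.
  - exact: lebesgue_tuple_setT_neq0.
  - exact: msec.
have int_pm : \int[mixed_site r l]_y pm (dfwith x l y) =
    C * (pa (dfwith x l (r l)) + expR h * I).
  rewrite (@Rintegral_mixed_measure _ _ _ _ _ _
    (fun y => pa (dfwith x l y)) (C * expR h)).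
  - rewrite pm_section eqxx mul0r expR0 mul1r -/I; ring.
  - exact: measurable_tuple_set1.
  - exact: lebesgue_tuple_set1.
  - by rewrite mulr_ge0// ltW// expR_gt0.
  - exact: msec.
  - by move=> y; exact: ltW.
  - exact: msec.
  - by move=> y; exact: ltW.
  - exact: pa_fin.
  - by move=> y yr; rewrite pm_section yr mul1r mulrA.
have E0 : 0 < expR h by exact: expR_gt0.
have P0 := pa0 (dfwith x l (r l)).
have S0 : 0 < pa (dfwith x l (r l)) + expR h * I.
  by rewrite addr_gt0// mulr_gt0.
have rhoE : rho = pa (dfwith x l (r l)) / (pa (dfwith x l (r l)) + expR h * I).
  rewrite /rho /cond_density int_pm pm_section eqxx mul0r expR0 mul1r.
  by rewrite -mulf_div divff ?mul1r// gt_eqF.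
split; last first.
  rewrite rhoE /cond_density -/I -/h; field.
  by rewrite !gt_eqF// addrC.
have -> : ground r l x = 1 - nonground r l x by rewrite /nonground subKr.
have -> : nonground r l x = (x l != r l)%:R.
  rewrite -(nonground_dfwith r x); congr (nonground r l _).
  by apply: functional_extensionality_dep => j; case: dfwithP.
have [->|xr] := eqVneq (x l) (r l).
  by rewrite subr0 mulr1 mulr0 mul0r addr0.
rewrite subrr mulr0 add0r mulr1 rhoE /cond_density int_pm pm_section xr mul1r -/I.
by field; rewrite !gt_eqF.
Qed.
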